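(* Any finite-dimensional semilinear gentle algebra $\Lambda=K_{\boldsymbol{\sigma}}Q/\langle Z\rangle$ is nodal, connected with $\Gamma=K_{\boldsymbol{\sigma}'}Q^{\mathrm{cut}}(Z)$.
   Context: $K$ is a division ring, $(Q,Z)$ a gentle pair (locally gentle: each vertex head, resp. tail, of at most two arrows, and each arrow $b$ gives at most one admissible and at most one inadmissible length-2 path $cb$, and likewise $ba$; with finitely many admissible paths), $\boldsymbol{\sigma}\colon Q_1\to\operatorname{Aut}(K)$. $K_{\boldsymbol{\sigma}}Q$ is the semilinear path algebra: the $K$-ring generated by $e_v$ and arrows with the usual path-algebra relations and $a\lambda=\sigma_a(\lambda)a$. $Q^{\mathrm{cut}}(Z)$ (denoted in the paper by $Q$ with a scissors superscript) is the Zembyk excision: each relational vertex $v$ ($v=t(b)=h(a)$ for some $ba\in Z$) is split into two vertices $v(\sharp),v(\flat)$, arrows $a'$ correspond to arrows $a$, reattached so that $b'a'$ is a path exactly when $ba\notin Z$; and $\sigma'_{a'}=\sigma_a$. A finite-dimensional $K$-ring $\Lambda$ is nodal, connected with $\Gamma$, if it is a subring of a finite-dimensional hereditary $K$-ring $\Gamma$ such that (1) the embeddings $K\to\Lambda\to\Gamma$ compose to $K\to\Gamma$, (2) $\operatorname{rad}(\Lambda)=\operatorname{rad}(\Gamma)$, and (3) for every simple left $\Lambda$-module $U$, the left $\Lambda$-module $\Gamma\otimes_\Lambda U$ has length at most $2$. *)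

(* Defs.v *)
From HB Require Import structures.
From mathcomp Require Import all_boot all_order all_algebra.
Set Implicit Arguments. Unset Strict Implicit. Unset Printing Implicit Defensive.
Import GRing.Theory.
Local Open Scope ring_scope.

Definition division_ring (K : unitRingType) : Prop :=
  forall k : K, k != 0 -> k \is a GRing.unit.

(* Quivers: vertices V, arrows A, head hd and tail tl (a : tl a -> hd a).
   A length-2 path "b a" (first a, then b) requires tl b = hd a;
   Z : rel A, with Z b a meaning that the path "b a" belongs to Z.     *)

Definition adm_step (V A : finType) (hd tl : A -> V) (Z : rel A) : rel A :=
  fun a b => (tl b == hd a) && ~~ Z b a.

Definition admissible (V A : finType) (hd tl : A -> V) (Z : rel A)
  (s : seq A) : bool :=
  if s is a :: s' then path (adm_step hd tl Z) a s' else true.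

Definition gentle_pair (V A : finType) (hd tl : A -> V) (Z : rel A) : Prop :=
  [/\ (forall b a, Z b a -> tl b = hd a),
      (forall v, #|[set a | hd a == v]| <= 2)%N /\
      (forall v, #|[set a | tl a == v]| <= 2)%N,
      (forall b, #|[set c | (tl c == hd b) && ~~ Z c b]| <= 1)%N /\
      (forall b, #|[set c | (tl c == hd b) && Z c b]| <= 1)%N,
      (forall b, #|[set a | (hd a == tl b) && ~~ Z b a]| <= 1)%N /\
      (forall b, #|[set a | (hd a == tl b) && Z b a]| <= 1)%N
    & exists N : nat, forall s : seq A, admissible hd tl Z s -> (size s <= N)%N].

Definition relational (V A : finType) (tl : A -> V) (Z : rel A) (v : V) : bool :=
  [exists b, exists a, Z b a && (tl b == v)].

(* The Zembyk excision Q^cut(Z): vertex set V', the same arrows A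
   (a' corresponds to a), new head/tail maps hd' tl', and pi : V' -> V
   recording which vertex of Q a vertex of Q^cut comes from.  Relational
   vertices are split into exactly two vertices, the others are kept, and
   the arrows are reattached so that b'a' is a path exactly when ba is a
   path not in Z. *)
Definition cut_quiver (V A V' : finType) (hd tl : A -> V) (Z : rel A)
  (hd' tl' : A -> V') (pi : V' -> V) : Prop :=
  [/\ (forall a, pi (hd' a) = hd a),
      (forall a, pi (tl' a) = tl a),
      (forall b a, tl' b = hd' a <-> (tl b = hd a /\ ~~ Z b a))
    & (forall v, #|[set w | pi w == v]| = if relational tl Z v then 2 else 1)%N].

(* Defining relations of K_sigma Q / <Z> in a K-ring (S, psi) with
   images e v of the idempotents e_v and x a of the arrows a.          *)
Definition semilinear_rels (K : unitRingType) (V A : finType) (hd tl : A -> V)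
  (sigma : A -> {rmorphism K -> K}) (Z : rel A)
  (S : pzRingType) (psi : {rmorphism K -> S}) (e : V -> S) (x : A -> S) : Prop :=
  [/\ (forall v w, e v * e w = if v == w then e v else 0),
      \sum_(v : V) e v = 1,
      (forall v (l : K), e v * psi l = psi l * e v),
      (forall a, e (hd a) * x a = x a /\ x a * e (tl a) = x a)
    & (forall a (l : K), x a * psi l = psi (sigma a l) * x a) /\
      (forall b a, Z b a -> x b * x a = 0)].

(* (R, phi, e, x) is the K-ring generated by the e_v and the arrows subject
   to these relations, i.e. R = K_sigma Q / <Z> (universal property). *)
Definition is_semilinear_gentle_presentation (K : unitRingType) (V A : finType)
  (hd tl : A -> V) (sigma : A -> {rmorphism K -> K}) (Z : rel A)
  (R : pzRingType) (phi : {rmorphism K -> R}) (e : V -> R) (x : A -> R) : Prop :=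
  semilinear_rels hd tl sigma Z phi e x /\
  forall (S : pzRingType) (psi : {rmorphism K -> S}) (e' : V -> S) (x' : A -> S),
    semilinear_rels hd tl sigma Z psi e' x' ->
    exists f : {rmorphism R -> S},
      [/\ (forall l, f (phi l) = psi l), (forall v, f (e v) = e' v),
          (forall a, f (x a) = x' a)
        & forall g : {rmorphism R -> S},
            (forall l, g (phi l) = psi l) -> (forall v, g (e v) = e' v) ->
            (forall a, g (x a) = x' a) -> forall r, g r = f r].

Definition finite_dim_Kring (K : unitRingType) (R : pzRingType)
  (phi : {rmorphism K -> R}) : Prop :=
  exists (n : nat) (b : 'I_n -> R),
    forall r : R, exists c : 'I_n -> K, r = \sum_(i < n) phi (c i) * b i.

Definition left_ideal (R : pzRingType) (I : R -> Prop) : Prop :=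
  [/\ I 0, (forall x y, I x -> I y -> I (x - y)) & (forall r x, I x -> I (r * x))].

Definition maximal_left_ideal (R : pzRingType) (I : R -> Prop) : Prop :=
  [/\ left_ideal I, ~ I 1 &
      forall J : R -> Prop, left_ideal J -> (forall x, I x -> J x) ->
        (forall x, J x -> I x) \/ (forall x, J x)].

Definition rad (R : pzRingType) (r : R) : Prop :=
  forall I : R -> Prop, maximal_left_ideal I -> I r.

Definition submodule (R : pzRingType) (M : lmodType R) (P : M -> Prop) : Prop :=
  [/\ P 0, (forall x y, P x -> P y -> P (x - y)) & (forall (r : R) x, P x -> P (r *: x))].

Definition simple_module (R : pzRingType) (M : lmodType R) : Prop :=
  (exists u : M, u != 0) /\
  forall P : M -> Prop, submodule P -> (forall u, P u -> u = 0) \/ (forall u, P u).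

Definition restr_submodule (L G : pzRingType) (iota : {rmorphism L -> G})
  (M : lmodType G) (P : M -> Prop) : Prop :=
  [/\ P 0, (forall x y, P x -> P y -> P (x - y)) & (forall (l : L) x, P x -> P (iota l *: x))].

Definition strict_incl (T : Type) (P Q : T -> Prop) : Prop :=
  (forall x, P x -> Q x) /\ exists x, Q x /\ ~ P x.

Definition restr_length_le2 (L G : pzRingType) (iota : {rmorphism L -> G})
  (M : lmodType G) : Prop :=
  ~ exists M0 M1 M2 M3 : M -> Prop,
      [/\ restr_submodule iota M0, restr_submodule iota M1,
          restr_submodule iota M2, restr_submodule iota M3 &
          [/\ strict_incl M0 M1, strict_incl M1 M2 & strict_incl M2 M3]].

Definition biadd_balanced (L G : pzRingType) (iota : {rmorphism L -> G})
  (U : lmodType L) (B : zmodType) (f : G -> U -> B) : Prop :=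
  [/\ (forall g1 g2 u, f (g1 + g2) u = f g1 u + f g2 u),
      (forall g u1 u2, f g (u1 + u2) = f g u1 + f g u2)
    & (forall g (l : L) u, f (g * iota l) u = f g (l *: u))].

Definition is_tensor (L G : pzRingType) (iota : {rmorphism L -> G})
  (U : lmodType L) (T : lmodType G) (beta : G -> U -> T) : Prop :=
  [/\ biadd_balanced iota beta,
      (forall g' g u, beta (g' * g) u = g' *: beta g u)
    & forall (B : zmodType) (f : G -> U -> B), biadd_balanced iota f ->
        exists h : T -> B,
          [/\ (forall t1 t2, h (t1 + t2) = h t1 + h t2),
              (forall g u, h (beta g u) = f g u)
            & forall h' : T -> B, (forall t1 t2, h' (t1 + t2) = h' t1 + h' t2) ->
                (forall g u, h' (beta g u) = f g u) -> forall t, h' t = h t]].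

Definition projective_left_ideal (G : pzRingType) (I : G -> Prop) : Prop :=
  forall (M N : lmodType G) (p : M -> N),
    (forall x y, p (x + y) = p x + p y) -> (forall (r : G) x, p (r *: x) = r *: p x) ->
    (forall n, exists m, p m = n) ->
    forall f : G -> N,
      (forall x y, I x -> I y -> f (x + y) = f x + f y) ->
      (forall r x, I x -> f (r * x) = r *: f x) ->
      exists k : G -> M,
        [/\ (forall x y, I x -> I y -> k (x + y) = k x + k y),
            (forall r x, I x -> k (r * x) = r *: k x)
          & (forall x, I x -> p (k x) = f x)].

Definition hereditary (G : pzRingType) : Prop :=
  forall I : G -> Prop, left_ideal I -> projective_left_ideal I.

Definition nodal_connected_with (K : unitRingType)
  (L : pzRingType) (phiL : {rmorphism K -> L})
  (G : pzRingType) (phiG : {rmorphism K -> G}) : Prop :=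
  [/\ finite_dim_Kring phiL, finite_dim_Kring phiG, hereditary G &
    exists iota : {rmorphism L -> G},
      [/\ injective iota,
          (forall l : K, iota (phiL l) = phiG l),
          (forall y : G, rad y <-> exists x : L, rad x /\ iota x = y)
        & forall (U : lmodType L), simple_module U ->
            forall (T : lmodType G) (beta : G -> U -> T), is_tensor iota beta ->
              restr_length_le2 iota T]].

(* Main.v *)
(* An arrow-by-arrow Taylor expansion r = \sum_v eps_v(r) e_v + \sum_a a r_a, where
   eps_v is the ring morphism to K killing the arrows and all e_w with w <> v,
   holds in K_sigma Q / <Z>; it identifies the radical as the common kernel of
   the eps_v, which is nilpotent since long admissible paths do not exist.  When
   Z is empty, r_a may be chosen as the value of a twisted derivation, so that
   left multiplication by an arrow a is injective on e_(tl a) G and the images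
   of distinct arrows are independent.  This yields both the injectivity of
   Lambda -> Gamma and the heredity of Gamma.  Finally a simple Lambda-module U
   is a line K u with e_v u = u, so that Gamma \otimes U is spanned over K by the
   elements e_w \otimes u, with w one of the at most two vertices above v. *)
From HB Require Import structures.
From mathcomp Require Import all_boot all_order all_algebra boolp.
Require Import Defs.
Set Implicit Arguments. Unset Strict Implicit. Unset Printing Implicit Defensive.
Import GRing.Theory.
Local Open Scope ring_scope.

Lemma subrACA (X : zmodType) (p q r s : X) : p - q - (r - s) = p - r - (q - s).
Proof. by rewrite !opprD addrACA. Qed.

(** * Induction from universal properties *)

Section SubringType.
Variables (R : pzRingType) (P : R -> Prop).
Hypotheses (P1 : P 1) (PB : forall x y, P x -> P y -> P (x - y)).
Hypothesis PM : forall x y, P x -> P y -> P (x * y).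

Definition subring_pred : {pred R} := fun x => `[< P x >].

Lemma subring_predP : subring_closed subring_pred.
Proof.
split; first exact/asboolP.
  by move=> x y /asboolP Px /asboolP Py; apply/asboolP/PB.
by move=> x y /asboolP Px /asboolP Py; apply/asboolP/PM.
Qed.

Definition subring_sort := {x : R | x \in subring_pred}.
HB.instance Definition _ := Choice.on subring_sort.
HB.instance Definition _ := SubType.on subring_sort.
HB.instance Definition _ :=
  GRing.SubChoice_isSubPzRing.Build R subring_pred subring_sort subring_predP.

(** The universal property maps [R] into the subring cut out by [P]. Followed by the inclusion, this
    map fixes the generators, so by uniqueness it is the identity. *)
Lemma subring_factor (K : unitRingType) (V A : finType) (hd tl : A -> V)
    (sigma : A -> {rmorphism K -> K}) (Z : rel A)
    (phi : {rmorphism K -> R}) (e : V -> R) (x : A -> R) :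
  is_semilinear_gentle_presentation hd tl sigma Z phi e x ->
  (forall l, P (phi l)) -> (forall v, P (e v)) -> (forall a, P (x a)) ->
  forall r, P r.
Proof.
move=> [[ee esum ephi ex [xphi xx]] univ] Pphi Pe Px.
pose lift y (Py : P y) : subring_sort := Sub y (asboolT Py).
have liftE y (Py : P y) : \val (lift y Py) = y by [].
pose psi l := lift _ (Pphi l).
have psiB : zmod_morphism psi.
  by move=> l m; apply: val_inj; rewrite raddfB /= rmorphB.
have psiM : monoid_morphism psi.
  by split=> [|l m]; apply: val_inj; rewrite ?rmorphM ?rmorph1 /= ?rmorph1 ?rmorphM.
pose psi' : {rmorphism K -> subring_sort} :=
  HB.pack psi (GRing.isZmodMorphism.Build _ _ psi psiB)
              (GRing.isMonoidMorphism.Build _ _ psi psiM).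
have [|f [fphi fe fx _]] :=
    univ _ psi' (fun v => lift _ (Pe v)) (fun a => lift _ (Px a)).
  split.
  - by move=> v w; apply: val_inj; rewrite rmorphM /= ee; case: eqP.
  - by apply: val_inj; rewrite rmorph1 raddf_sum.
  - by move=> v l; apply: val_inj; rewrite !rmorphM /= ephi.
  - by move=> a; split; apply: val_inj; rewrite !rmorphM /=; case: (ex a).
  - split=> [a l|b a zba]; apply: val_inj; rewrite !rmorphM /= ?rmorph0.
      exact: xphi.
    exact: xx.
have [|h [_ _ _ uniq]] := univ R phi e x; first by split.
move=> r; rewrite -[r]/(idfun r) uniq // -(uniq (\val \o f)).
- exact/asboolP/(valP (f r)).
- by move=> l /=; rewrite fphi.
- by move=> v /=; rewrite fe.
- by move=> a /=; rewrite fx.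
Qed.
End SubringType.

Section SubgroupType.
Variables (G : pzRingType) (T : lmodType G) (P : T -> Prop).
Hypotheses (P0 : P 0) (PB : forall t t', P t -> P t' -> P (t - t')).

Definition subgroup_pred : {pred T} := fun t => `[< P t >].

Lemma subgroup_predP : zmod_closed subgroup_pred.
Proof.
split; first exact/asboolP.
by move=> t t' /asboolP Pt /asboolP Pt'; apply/asboolP/PB.
Qed.

Definition subgroup_sort := {t : T | t \in subgroup_pred}.
HB.instance Definition _ := Choice.on subgroup_sort.
HB.instance Definition _ := SubType.on subgroup_sort.
HB.instance Definition _ :=
  GRing.SubChoice_isSubZmodule.Build T subgroup_pred subgroup_sort subgroup_predP.
(** Again [beta] corestricts to the subgroup cut out by [P], and uniqueness identifies the composite
    with the identity. A subgroup suffices because the universal property only tests additive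
    maps. *)
Lemma tensor_ind (L : pzRingType) (iota : {rmorphism L -> G}) (U : lmodType L)
    (beta : G -> U -> T) :
  is_tensor iota beta -> (forall g u, P (beta g u)) -> forall t, P t.
Proof.
move=> [[bDl bDr bal] _ univ] Pbeta t.
pose f g u : subgroup_sort := Sub (beta g u) (asboolT (Pbeta g u)).
have [|h [hD hf _]] := univ subgroup_sort f.
  by split=> *; apply: val_inj; rewrite ?raddfD /=; [exact: bDl|exact: bDr|exact: bal].
have [//|h0 [_ _ uniq]] := univ T beta.
rewrite -[t]/(idfun t) uniq // -(uniq (\val \o h)).
- exact/asboolP/(valP (h t)).
- by move=> t1 t2; rewrite -[LHS]/(\val (h (t1 + t2))) hD raddfD.
- by move=> g u; rewrite /= hf.
Qed.
End SubgroupType.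

(** * Augmentations and the radical *)

Section SemilinearGentle.
Variables (K : unitRingType) (V A : finType) (hd tl : A -> V).
Variables (sigma tau : A -> {rmorphism K -> K}) (Z : rel A).
Hypothesis HK : division_ring K.
Hypothesis sigmaK : forall a, cancel (sigma a) (tau a).
Hypothesis tauK : forall a, cancel (tau a) (sigma a).
Variables (R : pzRingType) (phi : {rmorphism K -> R}) (e : V -> R) (x : A -> R).
Hypothesis HR : is_semilinear_gentle_presentation hd tl sigma Z phi e x.

Let relsR : semilinear_rels hd tl sigma Z phi e x := proj1 HR.

Lemma mul_ee v w : e v * e w = if v == w then e v else 0.
Proof. by case: relsR. Qed.

Lemma sum_e : \sum_v e v = 1.
Proof. by case: relsR. Qed.

Lemma mul_ephi v l : e v * phi l = phi l * e v.
Proof. by case: relsR. Qed.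

Lemma mul_hdx a : e (hd a) * x a = x a.
Proof. by case: relsR => _ _ _ /(_ a) []. Qed.

Lemma mul_xtl a : x a * e (tl a) = x a.
Proof. by case: relsR => _ _ _ /(_ a) []. Qed.

Lemma mul_xphi a l : x a * phi l = phi (sigma a l) * x a.
Proof. by case: relsR => _ _ _ _ []. Qed.

Lemma mul_phix a l : phi l * x a = x a * phi (tau a l).
Proof. by rewrite mul_xphi tauK. Qed.

Lemma mul_ex v a : e v * x a = if v == hd a then x a else 0.
Proof. by rewrite -mul_hdx mulrA mul_ee; case: eqP => [->|]; rewrite ?mul0r. Qed.

Lemma mul_xx0 a b : ~~ adm_step hd tl Z a b -> x b * x a = 0.
Proof.
rewrite negb_and negbK => /orP[/eqP nba|Zba].
  by rewrite -mul_xtl -mulrA mul_ex; case: eqP => // _; rewrite mulr0.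
by case: relsR => _ _ _ _ [_]; apply.
Qed.

Lemma generator_ind (P : R -> Prop) :
  P 1 -> (forall r s, P r -> P s -> P (r - s)) ->
  (forall r s, P r -> P s -> P (r * s)) ->
  (forall l, P (phi l)) -> (forall v, P (e v)) -> (forall a, P (x a)) ->
  forall r, P r.
Proof. by move=> P1 PB PM; apply: (subring_factor P1 PB PM HR). Qed.

Lemma augmentation_ex v : exists f : {rmorphism R -> K},
  [/\ forall l, f (phi l) = l, forall w, f (e w) = (v == w)%:R
    & forall a, f (x a) = 0].
Proof.
have [|f [fphi fe fx _]] :=
  proj2 HR K idfun (fun w => (v == w)%:R) (fun=> 0); last by exists f.
split.
- move=> w w'; case: (eqVneq v w) => [<-|_]; rewrite ?mul1r ?mul0r.
    by case: eqP.
  by case: ifP.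
- by rewrite (bigD1 v) //= eqxx big1 ?addr0 // => w /negPf; rewrite eq_sym => ->.
- by move=> w l; rewrite mulr_natl mulr_natr.
- by move=> a; rewrite mulr0 mul0r.
- by split=> *; rewrite ?mul0r ?mulr0.
Qed.

Definition augmentation v : {rmorphism R -> K} := projT1 (cid (augmentation_ex v)).

Lemma aug_phi v l : augmentation v (phi l) = l.
Proof. by rewrite /augmentation; case: cid => f []. Qed.

Lemma aug_e v w : augmentation v (e w) = (v == w)%:R.
Proof. by rewrite /augmentation; case: cid => f []. Qed.

Lemma aug_x v a : augmentation v (x a) = 0.
Proof. by rewrite /augmentation; case: cid => f []. Qed.

(** The projection of [R] onto the [K]-span of the idempotents; it packs all augmentations into one
    multiplicative map. *)
Definition degree0 r : R := \sum_v phi (augmentation v r) * e v.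

Lemma degree0B r s : degree0 (r - s) = degree0 r - degree0 s.
Proof. by rewrite -sumrB; apply: eq_bigr => v _; rewrite !rmorphB mulrBl. Qed.

Lemma e_degree0 v r : e v * degree0 r = phi (augmentation v r) * e v.
Proof.
rewrite mulr_sumr (bigD1 v) //= mulrA mul_ephi -mulrA mul_ee eqxx big1 ?addr0 //.
by move=> w /negPf nwv; rewrite mulrA mul_ephi -mulrA mul_ee eq_sym nwv mulr0.
Qed.

Lemma degree0M r s : degree0 (r * s) = degree0 r * degree0 s.
Proof.
rewrite {2}/degree0 mulr_suml; apply: eq_bigr => v _.
by rewrite -mulrA e_degree0 mulrA !rmorphM.
Qed.

Lemma degree0_x r a : degree0 r * x a = x a * phi (tau a (augmentation (hd a) r)).
Proof.
rewrite mulr_suml (bigD1 (hd a)) //= -mulrA mul_hdx mul_phix big1 ?addr0 // => v nv.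
by rewrite -mulrA mul_ex (negPf nv) mulr0.
Qed.

Lemma degree0_phi l : degree0 (phi l) = phi l.
Proof.
rewrite -[RHS]mulr1 -sum_e mulr_sumr.
by apply: eq_bigr => v _; rewrite aug_phi.
Qed.

Lemma degree0_e v : degree0 (e v) = e v.
Proof.
rewrite /degree0 (bigD1 v) //= aug_e eqxx rmorph1 mul1r big1 ?addr0 // => w.
by move=> /negPf nwv; rewrite aug_e nwv rmorph0 mul0r.
Qed.

Lemma degree0_xM a r : degree0 (x a * r) = 0.
Proof.
by rewrite [LHS]big1 // => v _; rewrite rmorphM aug_x mul0r rmorph0 mul0r.
Qed.

Lemma degree0_eq0 r : (forall v, augmentation v r = 0) -> degree0 r = 0.
Proof. by move=> r0; rewrite [LHS]big1 // => v _; rewrite r0 rmorph0 mul0r. Qed.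

Lemma x_degree0 a r : x a * degree0 r = x a * phi (augmentation (tl a) r).
Proof. by rewrite -{1}mul_xtl -mulrA e_degree0 -mul_ephi mulrA mul_xtl. Qed.

Lemma expansion r : exists r_ : A -> R, r = degree0 r + \sum_a x a * r_ a.
Proof.
suff: exists r_ : A -> R, r - degree0 r = \sum_a x a * r_ a.
  by case=> r_ rE; exists r_; rewrite -rE addrC subrK.
have sum0 : 0 = \sum_a x a * 0 by rewrite big1 // => a _; rewrite mulr0.
elim/generator_ind: r => [|r s|r s|l|v|a].
- by exists (fun=> 0); rewrite -sum0 -(rmorph1 phi) degree0_phi subrr.
- move=> [r_ rE] [s_ sE]; exists (fun a => r_ a - s_ a).
  rewrite degree0B subrACA rE sE -sumrB.
  by apply: eq_bigr => a _; rewrite mulrBr.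
- move=> [r_ rE] [s_ sE].
  (* The product splits as below, and moving [degree0 r] to the right past [x a] leaves a scalar
     twisted by [tau a]. *)
  exists (fun a => r_ a * s + phi (tau a (augmentation (hd a) r)) * s_ a).
  transitivity ((r - degree0 r) * s + degree0 r * (s - degree0 s)).
    by rewrite degree0M mulrBl mulrBr addrA subrK.
  rewrite rE sE mulr_suml mulr_sumr -big_split; apply: eq_bigr => a _ /=.
  by rewrite mulrDr !mulrA degree0_x.
- by exists (fun=> 0); rewrite -sum0 degree0_phi subrr.
- by exists (fun=> 0); rewrite -sum0 degree0_e subrr.
- exists (fun b => (a == b)%:R).
  rewrite -{2}[x a]mulr1 degree0_xM subr0 (bigD1 a) //= eqxx mulr1 big1 ?addr0 //.
  by move=> b /negPf; rewrite eq_sym => ->; rewrite mulr0.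
Qed.

Lemma expansion0 r : (forall v, augmentation v r = 0) ->
  exists r_ : A -> R, r = \sum_a x a * r_ a.
Proof.
move=> r0; have [r_ {1}->] := expansion r; exists r_.
by rewrite degree0_eq0 // add0r.
Qed.

(** The list follows the order of traversal, as in [admissible], so its head is the rightmost
    factor. *)
Fixpoint word s : R := if s is a :: s' then word s' * x a else 1.

Lemma word_admissible s : ~~ admissible hd tl Z s -> word s = 0.
Proof.
case: s => //= a s; elim: s a => //= b s IH a; rewrite negb_and.
by case/orP=> [/mul_xx0 x0|/IH ->]; rewrite ?mul0r // -mulrA x0 mulr0.
Qed.

(** * Nilpotency and the Jacobson radical *)

Variable N : nat.
Hypothesis bounded : forall s, admissible hd tl Z s -> (size s <= N)%N.

Lemma word_eq0 s : (N < size s)%N -> word s = 0.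
Proof.
move=> sN; apply: word_admissible; apply/negP => /bounded.
by rewrite leqNgt sN.
Qed.

(* Iterating the hypothesis writes d as a combination of words of length > N. *)
Lemma arrow_descent (M : lmodType R) (D : nat -> M -> Prop) :
  (forall n d, D n.+1 d ->
     exists d_, (forall a : A, D n (d_ a)) /\ d = \sum_a x a *: d_ a) ->
  forall d, D N.+1 d -> d = 0.
Proof.
move=> step.
suff main n s d : (N < size s + n)%N -> D n d -> word s *: d = 0.
  by move=> d /(main N.+1 [::]); rewrite /= scale1r; apply.
elim: n s d => [|n IH] s d; first by rewrite addn0 => /word_eq0-> _; rewrite scale0r.
rewrite addnS -addSn => lt_N /step [d_ [Dd_ ->]].
rewrite scaler_sumr big1 // => a _; rewrite scalerA.
exact: (IH (a :: s)).
Qed.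

Lemma augmentation0_nilpotent r :
  (forall v, augmentation v r = 0) -> r ^+ N.+1 = 0.
Proof.
(* Level [n] of the descent consists of the left multiples of [r ^+ n]; the factor [s * r] has zero
   augmentations, so it expands in the arrows. *)
move=> r0; apply: (@arrow_descent R^o (fun n d => exists s, d = s * r ^+ n)); last first.
  by exists 1; rewrite mul1r.
move=> n _ [s ->]; have [v|r_ rE] := @expansion0 (s * r); first by rewrite rmorphM r0 mulr0.
exists (fun a => r_ a * r ^+ n); split=> [a|]; first by exists (r_ a).
by rewrite exprS mulrA rE mulr_suml; apply: eq_bigr => a _; rewrite -mulrA.
Qed.

(** Each augmentation kernel is maximal because [K] is a division ring. Conversely, if a maximal [I]
    failed to contain the common kernel, then [1] would be the sum of an element of [I] and a
    nilpotent one, which forces a unit into [I]. *)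
Lemma radP r : rad r <-> forall v, augmentation v r = 0.
Proof.
split=> [rad_r v|r0 I [[I0 IB IM] I1 Imax]].
  apply: (rad_r (fun s => augmentation v s = 0)); split.
  - split=> [|s t s0 t0|s t t0]; first exact: rmorph0.
      by rewrite rmorphB s0 t0 subr0.
    by rewrite rmorphM t0 mulr0.
  - by rewrite rmorph1; apply/eqP; exact: oner_neq0.
  - move=> J [J0 JB JM] IJ.
    have [Js|/existsNP [s /not_implyP [Js /eqP s0]]] :=
      pselect (forall s, J s -> augmentation v s = 0); first by left.
    (* Rescaling [s] by a quotient in [K] gives it the same augmentation as [t], so their difference
       lies in the kernel. *)
    right=> t; have Jt : J (phi (augmentation v t / augmentation v s) * s) by exact: JM.
    have Jd : J (phi (augmentation v t / augmentation v s) * s - t).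
      by apply: IJ; rewrite rmorphB rmorphM aug_phi divrK ?subrr //; apply: HK.
    by rewrite -[t](subKr (phi (augmentation v t / augmentation v s) * s)); apply: JB.
pose J s := exists i j, [/\ I i, forall v, augmentation v j = 0 & s = i - j].
have [||JI|J1] := Imax J.
- split; first by exists 0, 0; split; rewrite ?subr0 // => v; rewrite rmorph0.
    move=> _ _ [i [j [Ii j0 ->]]] [i' [j' [Ii' j'0 ->]]].
    exists (i - i'), (j - j'); split; [exact: IB| |exact: subrACA].
    by move=> v; rewrite rmorphB j0 j'0 subr0.
  move=> s _ [i [j [Ii j0 ->]]]; exists (s * i), (s * j).
  split; [exact: IM| |by rewrite mulrBr].
  by move=> v; rewrite rmorphM j0 mulr0.
- by move=> i Ii; exists i, 0; split; rewrite ?subr0 // => v; rewrite rmorph0.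
- by apply: JI; exists 0, (- r); split; rewrite ?opprK ?add0r // => v; rewrite rmorphN r0 oppr0.
have [i [j [Ii j0 /eqP]]] := J1 1; rewrite eq_sym subr_eq => /eqP iE.
case: I1; have := subrX1 (- j) N.+1.
have nj0 v : augmentation v (- j) = 0 by rewrite rmorphN j0 oppr0.
rewrite (augmentation0_nilpotent nj0) sub0r => jE.
(* As [- j] is nilpotent, the geometric sum [q] inverts [i = 1 + j]. *)
pose q := \sum_(k < N.+1) (- j) ^+ k.
have comm_q : (- j - 1) * q = q * (- j - 1).
  apply/commr_sym/commrB; last exact: commr1.
  by apply/commr_sym/commr_sum => k _; apply: commrX; exact: commr_refl.
have -> : 1 = q * i :> R.
  by apply: oppr_inj; rewrite jE -/q comm_q -mulrN iE opprD addrC.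
exact: IM.
Qed.
End SemilinearGentle.

(** * Left ideals of a semilinear path algebra *)

Section LinearExtension.
Variables (K : unitRingType) (R : pzRingType) (phi : {rmorphism K -> R}).
Hypotheses (HK : division_ring K) (Hfin : finite_dim_Kring phi).
Variables (E M : lmodType R).
Implicit Types S Rel : E -> M -> Prop.

(** Partial, possibly multivalued maps are represented by their graphs. Since [T] acts through
    [act], one notion covers both linearity over [phi] and compatibility with the idempotents
    [e]. *)
Definition linear_relation (T : Type) (act : T -> R) S :=
  [/\ S 0 0, forall u m v n, S u m -> S v n -> S (u - v) (m - n)
    & forall t u m, S u m -> S (act t *: u) (act t *: m)].

Lemma linear_relationD (T : Type) (act : T -> R) S u m v n :
  linear_relation act S -> S u m -> S v n -> S (u + v) (m + n).
Proof.
move=> [S0 SB _] Sum Svn; rewrite -[v]opprK -[n]opprK; apply: (SB) => //.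
by rewrite -[- v]sub0r -[- n]sub0r; apply: SB.
Qed.

Lemma linear_relation_sum (T : Type) (act : T -> R) S (I : finType)
    (u : I -> E) (m : I -> M) :
  linear_relation act S -> (forall i, S (u i) (m i)) -> S (\sum_i u i) (\sum_i m i).
Proof.
move=> linS Sum; apply: (big_ind2 S) => [||i _]; [by case: linS| |exact: Sum].
by move=> *; apply: (linear_relationD linS).
Qed.

Definition single_valued S := forall m, S 0 m -> m = 0.

Lemma single_valuedP (T : Type) (act : T -> R) S u m n :
  linear_relation act S -> single_valued S -> S u m -> S u n -> m = n.
Proof.
move=> [_ SB _] S1 Sm Sn; apply/eqP; rewrite -subr_eq0; apply/eqP/S1.
by rewrite -(subrr u); apply: SB.
Qed.

(** The line spanned by [(b, m)], with [m] related to [b] by [Rel], is added to the graph. Values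
    remain unique: a nonzero multiple of [b] in the domain of [S] would put [b] itself there. *)
Lemma extend_relation Rel S (b : E) :
  linear_relation phi Rel -> (forall u, exists m, Rel u m) ->
  linear_relation phi S -> single_valued S -> (forall u m, S u m -> Rel u m) ->
  exists S', [/\ linear_relation phi S', single_valued S',
    forall u m, S' u m -> Rel u m, forall u m, S u m -> S' u m
    & exists m, S' b m].
Proof.
move=> linRel totRel linS S1 SRel.
have [Sb|nSb] := pselect (exists m, S b m); first by exists S.
have [m Rbm] := totRel b; have [S0 SB SZ] := linS.
exists (fun u y => exists l, S (u - phi l *: b) (y - phi l *: m)); split.
- split=> [|u y v z [l Sl] [k Sk]|l u y [k Sk]].
  + by exists 0; rewrite rmorph0 !scale0r !subr0.
  + exists (l - k); rewrite rmorphB !scalerBl.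
    by rewrite subrACA [y - z - _]subrACA; apply: SB.
  + by exists (l * k); rewrite rmorphM -!scalerA -!scalerBr; apply: SZ.
- move=> y [l]; have [->|l0] := eqVneq l 0.
    by rewrite rmorph0 !scale0r !subr0; apply: S1.
  move=> /(SZ (- l^-1)); rewrite sub0r rmorphN scaleNr scalerN opprK scalerA.
  rewrite -rmorphM mulVr ?rmorph1 ?scale1r; last exact: HK.
  by move=> Sb; case: nSb; eexists; exact: Sb.
- move=> u y [l /SRel Rl].
  rewrite -[u](subrK (phi l *: b)) -[y](subrK (phi l *: m)).
  by apply: (linear_relationD linRel) => //; case: linRel => _ _; apply.
- by move=> u y Suy; exists 0; rewrite rmorph0 !scale0r !subr0.
- by exists m, 1; rewrite rmorph1 !scale1r !subrr.
Qed.

(** [Rel] records a linear constraint on the extension, such as lifting a given map. Extending by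
    one vector at a time covers a finite spanning family, after which the graph is total. *)
Lemma linear_extension Rel S :
  linear_relation phi Rel -> (forall u, exists m, Rel u m) ->
  linear_relation phi S -> single_valued S -> (forall u m, S u m -> Rel u m) ->
  (exists (n : nat) (b : 'I_n -> E),
     forall u, exists c : 'I_n -> K, u = \sum_i phi (c i) *: b i) ->
  exists s : E -> M, [/\ zmod_morphism s,
    forall l u, s (phi l *: u) = phi l *: s u, forall u, Rel u (s u)
    & forall u m, S u m -> s u = m].
Proof.
move=> linRel totRel linS S1 SRel [n [b span]].
have [S' [linS' S'1 S'Rel SS' dom]] : exists S',
    [/\ linear_relation phi S', single_valued S',
    forall u m, S' u m -> Rel u m, forall u m, S u m -> S' u m
    & forall i, i \in enum 'I_n -> exists m, S' (b i) m].
  elim: (enum 'I_n) => [|i js [S' [linS' S'1 S'Rel SS' dom]]]; first by exists S.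
  have [T [linT T1 TRel S'T domT]] := extend_relation (b i) linRel totRel linS' S'1 S'Rel.
  exists T; split=> // [u m /SS'/S'T//|j]; rewrite inE => /predU1P [->//|/dom [m /S'T]].
  by exists m.
have tot u : exists m, S' u m.
  have [c ->] := span u.
  have [m S'm] := choice (fun i => dom i (mem_enum 'I_n i)).
  exists (\sum_i phi (c i) *: m i); apply: (linear_relation_sum linS') => i.
  by case: linS' => _ _; apply.
have [s S's] := choice tot; have [_ S'B S'Z] := linS'.
exists s; split=> [u v|l u|u|u m /SS' S'm].
- by apply: (single_valuedP linS' S'1 (S's _)); apply: S'B.
- by apply: (single_valuedP linS' S'1 (S's _)); apply: S'Z.
- exact: S'Rel.
- exact: (single_valuedP linS' S'1 (S's _) S'm).
Qed.

(** An averaging argument: a [K]-linear extension [s] is replaced by the sum of its compressions by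
    the [e v]. The constraint and the prescribed values survive because [Rel] and [S] are stable
    under [e]. *)
Lemma equivariant_extension (V : finType) (e : V -> R) Rel S :
  (forall v w, e v * e w = if v == w then e v else 0) -> \sum_v e v = 1 ->
  (forall v l, e v * phi l = phi l * e v) ->
  linear_relation phi Rel -> linear_relation e Rel ->
  (forall u, exists m, Rel u m) ->
  linear_relation phi S -> linear_relation e S -> single_valued S ->
  (forall u m, S u m -> Rel u m) ->
  (exists (n : nat) (b : 'I_n -> E),
     forall u, exists c : 'I_n -> K, u = \sum_i phi (c i) *: b i) ->
  exists s : {additive E -> M}, [/\ forall l u, s (phi l *: u) = phi l *: s u,
    forall v u, s (e v *: u) = e v *: s u, forall u, Rel u (s u)
    & forall u m, S u m -> s u = m].
Proof.
move=> ee esum ephi linRel eRel totRel linS eS S1 SRel span.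
have [s [sB sZ Rs sS]] := linear_extension linRel totRel linS S1 SRel span.
pose t u := \sum_v e v *: s (e v *: u).
have tB : zmod_morphism t.
  by move=> u v; rewrite -sumrB; apply: eq_bigr => w _; rewrite scalerBr sB scalerBr.
exists (HB.pack_for {additive E -> M} t (GRing.isZmodMorphism.Build _ _ t tB)).
have sum_ev (X : lmodType R) (u : X) : u = \sum_v e v *: u.
  by rewrite -scaler_suml esum scale1r.
have s0 : s 0 = 0 by rewrite -(subrr 0) sB subrr.
split=> /= [l u|w u|u|u m Sum].
- rewrite scaler_sumr; apply: eq_bigr => v _.
  by rewrite scalerA ephi -scalerA sZ !scalerA ephi.
- transitivity (e w *: s (e w *: u)).
    rewrite [LHS](bigD1 w) //= scalerA ee eqxx big1 ?addr0 // => v /negPf nvw.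
    by rewrite scalerA ee nvw scale0r s0 scaler0.
  rewrite scaler_sumr (bigD1 w) //= scalerA ee eqxx big1 ?addr0 // => v /negPf.
  by rewrite scalerA ee eq_sym => ->; rewrite scale0r.
- rewrite [u in Rel u]sum_ev; apply: (linear_relation_sum linRel) => v.
  suff {1}-> : e v *: u = e v *: (e v *: u) by case: eRel => _ _; apply.
  by rewrite scalerA ee eqxx.
- rewrite [m]sum_ev; apply: eq_bigr => v _.
  have [_ _ eS'] := eS; rewrite (sS _ _ (eS' v _ _ Sum)).
  by rewrite scalerA ee eqxx.
Qed.
End LinearExtension.

(** * Twisted derivations and heredity of the path algebra *)

Section SemilinearPath.
Variables (K : unitRingType) (V A : finType) (hd tl : A -> V).
Variables (sigma tau : A -> {rmorphism K -> K}).
Hypothesis HK : division_ring K.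
Hypothesis sigmaK : forall a, cancel (sigma a) (tau a).
Hypothesis tauK : forall a, cancel (tau a) (sigma a).
Variables (R : pzRingType) (phi : {rmorphism K -> R}) (e : V -> R) (x : A -> R).
Let noZ : rel A := fun _ _ => false.
Hypothesis HR : is_semilinear_gentle_presentation hd tl sigma noZ phi e x.
Notation eps := (augmentation HR).

(* The ring morphism to 2x2 upper triangular matrices with diagonal
   (tau_a (eps_(hd a) r), r) has the derivation as off-diagonal entry. *)
Lemma derivation_ex a : exists D : {additive R -> R},
  [/\ forall l r, D (phi l * r) = phi (tau a l) * D r,
      forall v r, D (e v * r) = if v == hd a then D r else 0,
      forall b r, D (x b * r) = if a == b then e (tl a) * r else 0
    & forall v, D (e v) = 0].
Proof.
pose U (p q r : R) : 'M[R]_(1 + 1) := block_mx p%:M q%:M 0 r%:M.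
have UM p q r p' q' r' :
    U p q r * U p' q' r' = U (p * p') (p * q' + q * r') (r * r').
  rewrite /U -[LHS]/(_ *m _) mulmx_block !mul0mx !mulmx0 !add0r (addr0 (p%:M *m p'%:M)).
  by rewrite -!scalar_mxM -raddfD.
have UB p q r p' q' r' : U p q r - U p' q' r' = U (p - p') (q - q') (r - r').
  by rewrite /U opp_block_mx add_block_mx -!raddfB /= oppr0 addr0.
have U1 : U 1 0 1 = 1 by rewrite -[RHS]/(1%:M) /U raddf0 -scalar_mx_block.
have U0 : U 0 0 0 = 0 by rewrite -(subrr (U 0 0 0)) UB !subrr.
have UD p q r p' q' r' : U p q r + U p' q' r' = U (p + p') (q + q') (r + r').
  by rewrite /U add_block_mx -!raddfD /= add0r.
have Uinj p q r p' q' r' : U p q r = U p' q' r' -> q = q'.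
  move=> /eq_block_mx [_ /(congr1 (fun X : 'M_1 => X 0 0))].
  by rewrite !mxE eqxx !mulr1n.
pose psi l := U (phi (tau a l)) 0 (phi l).
have psiB : zmod_morphism psi.
  by move=> l m; rewrite /psi UB !rmorphB subr0.
have psiM : monoid_morphism psi.
  by split=> [|l m]; rewrite /psi ?UM ?rmorph1 // !rmorphM mulr0 mul0r addr0.
pose psi' : {rmorphism K -> 'M[R]_(1 + 1)} :=
  HB.pack psi (GRing.isZmodMorphism.Build _ _ psi psiB)
              (GRing.isMonoidMorphism.Build _ _ psi psiM).
(* Among the generators only [x a] has a nonzero corner, [e (tl a)], so the derivation reads off the
   coefficient of [a]. *)
have [|f [fphi fe fx _]] := proj2 HR _ psi' (fun v => U (v == hd a)%:R 0 (e v))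
  (fun b => U 0 (if a == b then e (tl a) else 0) (x b)).
  split.
  - move=> v w; rewrite UM mulr0 mul0r addr0 (mul_ee HR).
    case: (eqVneq v w) => [<-|nvw].
      by case: eqP; rewrite ?mulr1 ?mulr0.
    case: (eqVneq v (hd a)) nvw => [->|_ _]; last by rewrite mul0r U0.
    by rewrite eq_sym => /negPf->; rewrite mulr0 U0.
  - have -> (F1 F2 : V -> R) : \sum_v U (F1 v) 0 (F2 v) = U (\sum_v F1 v) 0 (\sum_v F2 v).
      apply: (big_rec3 (fun y1 y2 y3 => y1 = U y2 0 y3)) => // v y1 y2 y3 _ ->.
      by rewrite UD addr0.
    rewrite (sum_e HR) -U1; congr U; rewrite (bigD1 (hd a)) //= eqxx big1 ?addr0 //.
    by move=> v /negPf->.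
  - by move=> v l; rewrite !UM !mulr0 !mul0r !addr0 (mul_ephi HR) mulr_natl mulr_natr.
  - move=> b; rewrite !UM !mulr0 !mul0r ?addr0 ?add0r (mul_hdx HR) (mul_xtl HR).
    by case: (eqVneq a b) => [<-|_]; rewrite ?eqxx ?mul1r ?mulr0 ?mul0r ?(mul_ee HR) ?eqxx.
  (* The zero relations are vacuous for [noZ]. Otherwise they could fail: the corner of the image of
     [x a * x c] is [e (tl a) * x c]. *)
  split=> // b l; rewrite !UM !mulr0 !mul0r addr0 add0r (mul_xphi HR).
  case: eqP => [<-|_]; rewrite ?mul0r ?mulr0 //.
  by rewrite sigmaK (mul_ephi HR).
have fE r : exists d, f r = U (phi (tau a (eps (hd a) r))) d r.
  elim/(generator_ind HR): r => [|r s [d dE] [d' d'E]|r s [d dE] [d' d'E]|l|v|b].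
  - by exists 0; rewrite !rmorph1 U1.
  - by exists (d - d'); rewrite rmorphB dE d'E UB !rmorphB.
  - by eexists; rewrite rmorphM dE d'E UM !rmorphM.
  - by exists 0; rewrite fphi (aug_phi HR).
  - by exists 0; rewrite fe (aug_e HR) !rmorph_nat eq_sym.
  - by eexists; rewrite fx (aug_x HR) !rmorph0.
pose D r : R := f r (lshift 1 0) (rshift 1 0).
have DE r : f r = U (phi (tau a (eps (hd a) r))) (D r) r.
  have [d dE] := fE r; rewrite dE; congr U.
  by rewrite /D dE /U block_mxEur mxE eqxx.
have DB : zmod_morphism D by move=> r s; rewrite /D rmorphB !mxE.
exists (HB.pack_for {additive R -> R} D (GRing.isZmodMorphism.Build _ _ D DB)).
(* The twisted Leibniz rule, read off from the corner of a product. *)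
have DM r s : D (r * s) = D r * s + phi (tau a (eps (hd a) r)) * D s.
  by have := DE (r * s); rewrite rmorphM !DE UM => /Uinj <-; rewrite addrC.
have De v : D (e v) = 0 by have := DE (e v); rewrite fe => /Uinj.
split=> [l r|v r|b r|//] /=; rewrite DM.
- have := DE (phi l); rewrite fphi => /Uinj <-.
  by rewrite mul0r add0r (aug_phi HR).
- rewrite De mul0r add0r (aug_e HR) eq_sym.
  by case: eqP; rewrite ?rmorph1 ?mul1r ?rmorph0 ?mul0r.
- have := DE (x b); rewrite fx => /Uinj <-; rewrite (aug_x HR) !rmorph0 mul0r addr0.
  by case: eqP; rewrite ?mul0r.
Qed.

Lemma partial_linearB (X Y : lmodType R) (P : X -> Prop) (f : X -> Y) :
  (forall u v, P u -> P v -> f (u + v) = f u + f v) ->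
  (forall r u, P u -> f (r *: u) = r *: f u) -> (forall r u, P u -> P (r *: u)) ->
  forall u v, P u -> P v -> f (u - v) = f u - f v.
Proof.
move=> fD fZ PZ u v Pu Pv; rewrite -scaleN1r fD //; last exact: PZ.
by rewrite fZ // scaleN1r.
Qed.

Variable N : nat.
Hypothesis bounded : forall s, admissible hd tl noZ s -> (size s <= N)%N.
Hypothesis Hfin : finite_dim_Kring phi.

Let span : exists (n : nat) (b : 'I_n -> R^o),
  forall u, exists c : 'I_n -> K, u = \sum_i phi (c i) *: b i.
Proof. by have [n [b span]] := Hfin; exists n, b. Qed.

(** The identity of [P] is extended under the constraint that all values lie in [P], which yields a
    retraction onto [P]. *)
Lemma equivariant_projector (P : R -> Prop) :
  P 0 -> (forall r s, P r -> P s -> P (r - s)) ->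
  (forall l r, P r -> P (phi l * r)) -> (forall v r, P r -> P (e v * r)) ->
  exists pr : {additive R -> R}, [/\ forall l r, pr (phi l * r) = phi l * pr r,
    forall v r, pr (e v * r) = e v * pr r, forall r, P (pr r)
    & forall r, P r -> pr r = r].
Proof.
move=> P0 PB Pphi Pe.
have [| | | | | | | | | | |pr [prphi pre Ppr prK]] := @equivariant_extension K R phi HK R^o R^o
  V e (fun _ s => P s) (fun r s => P r /\ s = r).
- exact: mul_ee HR.
- exact: sum_e HR.
- exact: mul_ephi HR.
- by split=> // [u m v n|l u m]; [exact: PB|exact: Pphi].
- by split=> // [u m v n|l u m]; [exact: PB|exact: Pe].
- by exists 0.
- by split=> // [u m v n [Pu ->] [Pv ->]|l u m [Pu ->]]; split=> //; [exact: PB|exact: Pphi].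
- by split=> // [u m v n [Pu ->] [Pv ->]|l u m [Pu ->]]; split=> //; [exact: PB|exact: Pe].
- by move=> m [].
- by move=> u m [Pu ->].
- exact: span.
by exists pr; split=> // r Pr; apply: prK.
Qed.

Section LeftIdeal.
Variables (I : R -> Prop) (HI : left_ideal I).

Let I0 : I 0. Proof. by case: HI. Qed.
Let IB r s : I r -> I s -> I (r - s). Proof. by case: HI => _ H _; apply: H. Qed.
Let IM r s : I s -> I (r * s). Proof. by case: HI => _ _; apply. Qed.

Let ID r s : I r -> I s -> I (r + s).
Proof. by move=> Ir Is; rewrite -[s]opprK -[- s]mulN1r; apply/IB/IM. Qed.

(** The product of the radical, which is the right ideal generated by the arrows, with [I]. *)
Definition radical_part r := exists y : A -> R, (forall a, I (y a)) /\ r = \sum_a x a * y a.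

Lemma radical_part_sub r : radical_part r -> I r.
Proof.
move=> [y [Iy ->]]; elim/big_ind: _ => [|r' s|a _]; [exact: I0|exact: ID|].
exact: IM.
Qed.

Lemma radical_partB r s : radical_part r -> radical_part s -> radical_part (r - s).
Proof.
move=> [y [Iy ->]] [z [Iz ->]]; exists (fun a => y a - z a); split=> [a|]; first exact: IB.
by rewrite -sumrB; apply: eq_bigr => a _; rewrite mulrBr.
Qed.

Lemma radical_part0 : radical_part 0.
Proof. by exists (fun=> 0); split=> [_|]; rewrite ?big1 // => a _; rewrite mulr0. Qed.

Lemma radical_part_phi l r : radical_part r -> radical_part (phi l * r).
Proof.
move=> [y [Iy ->]]; exists (fun a => phi (tau a l) * y a); split=> [a|]; first exact: IM.
by rewrite mulr_sumr; apply: eq_bigr => a _; rewrite !mulrA (mul_phix tauK HR).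
Qed.

Lemma radical_part_e v r : radical_part r -> radical_part (e v * r).
Proof.
move=> [y [Iy ->]]; exists (fun a => (v == hd a)%:R * y a).
split=> [a|]; first exact: IM.
rewrite mulr_sumr; apply: eq_bigr => a _; rewrite mulrA (mul_ex HR).
by case: eqP; rewrite ?mul1r ?mul0r ?mulr0.
Qed.

Lemma radical_part_x a r : I r -> radical_part (x a * r).
Proof.
move=> Ir; exists (fun b => (b == a)%:R * r); split=> [b|]; first exact: IM.
rewrite (bigD1 a) //= eqxx mul1r big1 ?addr0 // => b /negPf->.
by rewrite mul0r mulr0.
Qed.

(* A lift on I is determined by its values on a complement of the radical part
   of I, where only K- and e_v-linearity has to be met; it is propagated along
   the arrows by the fixed point equation
     k y = q y + \sum_a x a *: k (delta a y),
   whose iterates become stationary because long words vanish. *)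
Lemma left_ideal_projective : projective_left_ideal I.
Proof.
move=> M M' p pD pZ psurj f fD fZ.
have pB : zmod_morphism p.
  by move=> u v; apply: (@partial_linearB M M' (fun=> True)) => // *; rewrite ?pD ?pZ.
have p0 : p 0 = 0 by rewrite -(subrr 0) pB subrr.
have psum (F : A -> M) : p (\sum_a F a) = \sum_a p (F a).
  exact: (big_morph p pD p0).
have fB r s : I r -> I s -> f (r - s) = f r - f s.
  by move=> Ir Is; apply: (@partial_linearB R^o M' I) => // *; exact: IM.
have f0 : f 0 = 0 by rewrite -(subrr 0) fB // subrr.
have fsum (F : A -> R) : (forall a, I (F a)) -> f (\sum_a F a) = \sum_a f (F a).
  move=> IF; have [] // : I (\sum_a F a) /\ f (\sum_a F a) = \sum_a f (F a).
  elim/big_rec2: _ => // a _ r _ [Ir <-]; split; first exact: ID.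
  exact: fD.
(* Since [f] is linear only on [I], precomposing with [prI] gives a map that is linear on all of
   [R]. *)
have [prI [prIphi prIe IprI prIK]] := equivariant_projector I0 IB
  (fun l r => @IM (phi l) r) (fun v r => @IM (e v) r).
have [prJ [prJphi prJe JprJ prJK]] := equivariant_projector radical_part0 radical_partB
  radical_part_phi radical_part_e.
(* [s] lifts [f \o prI] through [p], compatibly with scalars and idempotents only. No value is
   prescribed, so the initial graph is zero. *)
have [| | | | | | | | | | |s [sphi se ps _]] := @equivariant_extension K R phi HK R^o M
  V e (fun r m => p m = f (prI r)) (fun r m => r = 0 /\ m = 0).
- exact: mul_ee HR.
- exact: sum_e HR.
- exact: mul_ephi HR.
- split=> [|u m v n pm pn|l u m pm]; first by rewrite raddf0 f0 p0.
    by rewrite raddfB fB // pB pm pn.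
  by rewrite prIphi fZ // pZ pm.
- split=> [|u m v n pm pn|l u m pm]; first by rewrite raddf0 f0 p0.
    by rewrite raddfB fB // pB pm pn.
  by rewrite prIe fZ // pZ pm.
- by move=> r; exact: psurj.
- by split=> // [u m v n [-> ->] [-> ->]|l u m [-> ->]]; rewrite ?subr0 ?scaler0.
- by split=> // [u m v n [-> ->] [-> ->]|l u m [-> ->]]; rewrite ?subr0 ?scaler0.
- by move=> m [].
- by move=> u m [-> ->]; rewrite raddf0 f0 p0.
- exact: span.
have [D HD] := choice derivation_ex.
have Dphi a l r : D a (phi l * r) = phi (tau a l) * D a r by case: (HD a).
have De a v r : D a (e v * r) = if v == hd a then D a r else 0 by case: (HD a).
have Dx a b r : D a (x b * r) = if a == b then e (tl a) * r else 0 by case: (HD a).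
pose delta a r := D a (prJ r).
have D_radical a y : D a (\sum_b x b * y b) = e (tl a) * y a.
  rewrite raddf_sum (bigD1 a) //= Dx eqxx big1 ?addr0 // => b nba.
  by rewrite Dx eq_sym (negPf nba).
have Idelta a r : I (delta a r).
  by have [y [Iy yE]] := JprJ r; rewrite /delta yE D_radical; exact: IM.
have deltaE r : prJ r = \sum_a x a * delta a r.
  have [y [Iy yE]] := JprJ r; rewrite {1}yE; apply: eq_bigr => a _.
  by rewrite /delta yE D_radical mulrA (mul_xtl HR).
pose q r := s (r - prJ r).
pose step (k : R -> M) r := q r + \sum_a x a *: k (delta a r).
pose k n := iter n step (fun=> 0).
have kE n r : k n.+1 r = q r + \sum_a x a *: k n (delta a r) by [].
(* A difference of consecutive iterates is a combination, over the arrows, of the previous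
   differences at [delta a r], so at level [N.+1] it vanishes. *)
have stable r : k N.+2 r = k N.+1 r.
  apply/eqP; rewrite -subr_eq0; apply/eqP.
  apply: (arrow_descent HR bounded
    (D := fun n m => exists r, m = k n.+1 r - k n r)); last by exists r.
  move=> n _ [t ->]; exists (fun a => k n.+1 (delta a t) - k n (delta a t)).
  split=> [a|]; first by exists (delta a t).
  rewrite (kE n.+1 t) (kE n t) opprD addrACA subrr add0r -sumrB.
  by apply: eq_bigr => a _; rewrite scalerBr.
have kB n : zmod_morphism (k n).
  elim: n => [|n IH] u v; first by rewrite /= subr0.
  have qB : q (u - v) = q u - q v by rewrite /q (raddfB prJ) subrACA (raddfB s).
  rewrite !kE qB opprD addrACA; congr (_ + _).
  by rewrite -sumrB; apply: eq_bigr => a _; rewrite /delta !raddfB IH scalerBr.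
have k0 n : k n 0 = 0 by rewrite -(subrr 0) kB subrr.
have kphi n l r : k n (phi l * r) = phi l *: k n r.
  elim: n l r => [|n IH] l r; first by rewrite /= scaler0.
  rewrite !kE scalerDr /q prJphi -mulrBr sphi scaler_sumr; congr (_ + _).
  apply: eq_bigr => a _.
  by rewrite /delta prJphi Dphi IH !scalerA (mul_phix tauK HR).
have ke n v r : k n (e v * r) = e v *: k n r.
  elim: n r => [|n IH] r; first by rewrite /= scaler0.
  rewrite !kE scalerDr /q prJe -mulrBr se scaler_sumr; congr (_ + _).
  apply: eq_bigr => a _.
  rewrite /delta prJe De scalerA (mul_ex HR).
  by case: eqP; rewrite ?k0 ?scaler0 ?scale0r.
pose kk := k N.+1.
have kkE r : kk r = q r + \sum_a x a *: kk (delta a r) by rewrite -kE stable.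
(* On [x a * r] the projection [prJ] is the identity, so [q] vanishes and the derivations isolate
   the term of [a]. *)
have kx a r : I r -> kk (x a * r) = x a *: kk r.
  move=> Ir; rewrite kkE /q /delta prJK; last exact: radical_part_x.
  rewrite subrr raddf0 add0r (bigD1 a) //= Dx eqxx big1 ?addr0 => [|b nba].
    by rewrite /kk ke scalerA (mul_xtl HR).
  by rewrite Dx (negPf nba) /kk k0 scaler0.
have kM r t : I t -> kk (r * t) = r *: kk t.
  elim/(generator_ind HR): r t => [|r1 r2 IH1 IH2|r1 r2 IH1 IH2|l|v|a] t It.
  - by rewrite mul1r scale1r.
  - by rewrite mulrBl /kk kB -/kk IH1 // IH2 // scalerBl.
  - by rewrite -mulrA IH1 ?IH2 ?scalerA //; exact: IM.
  - exact: kphi.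
  - exact: ke.
  - exact: kx.
exists kk; split=> [u v _ _|r u Iu|u Iu]; [|exact: kM|].
  by rewrite -[in LHS](opprK v) /kk kB -[- v]sub0r kB k0 sub0r opprK.
apply/eqP; rewrite -subr_eq0; apply/eqP.
(* The lifting error on [I] is a combination, over the arrows, of errors at elements of [I] again;
   the levels of the descent all coincide. *)
apply: (arrow_descent HR bounded
  (D := fun _ m => exists2 r, I r & m = p (kk r) - f r)); last by exists u.
move=> _ _ [r Ir ->]; exists (fun a => p (kk (delta a r)) - f (delta a r)).
split=> [a|]; first by exists (delta a r).
have IprJ : I (prJ r) by apply: radical_part_sub.
rewrite kkE pD ps prIK; last exact: IB.
rewrite fB // addrAC [f r - _ - _]addrAC subrr sub0r deltaE fsum => [|a]; last exact: IM.
rewrite psum addrC -sumrB; apply: eq_bigr => a _.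
by rewrite fZ // pZ scalerBr.
Qed.
End LeftIdeal.
End SemilinearPath.

(** * Comparison with the excision *)

(** The annihilator of a nonzero vector of a simple module is a maximal left ideal. *)
Lemma simple_module_rad (R : pzRingType) (U : lmodType R) (r : R) (u : U) :
  simple_module U -> rad r -> r *: u = 0.
Proof.
move=> [_ simpleU] rad_r; have [->|u0] := eqVneq u 0; first exact: scaler0.
apply: (rad_r (fun s => s *: u = 0)); split.
- split=> [|s t su tu|s t tu]; first exact: scale0r.
    by rewrite scalerBl su tu subr0.
  by rewrite -scalerA tu scaler0.
- by rewrite scale1r; apply/eqP.
- move=> J [J0 JB JM] uJ; have [|JU|JU] := simpleU (fun w => exists2 s, J s & w = s *: u).
  + split=> [|_ _ [s Js ->] [t Jt ->]|s _ [t Jt ->]].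
    * by exists 0; rewrite ?scale0r.
    * by exists (s - t); rewrite ?scalerBl //; exact: JB.
    * by exists (s * t); rewrite ?scalerA //; exact: JM.
  + by left=> s Js; apply: JU; exists s.
  (* From [u = t *: u] with [t] in [J], the element [1 - t] annihilates [u], so [J] contains [1]. *)
  + right=> s; have [t Jt uE] := JU u; rewrite -[s]mulr1; apply: JM.
    rewrite -[1](subKr t); apply: JB => //; apply: uJ.
    by rewrite scalerBl scale1r -uE subrr.
Qed.

(** Restricted submodules are [K]-subspaces, so this is linear algebra in dimension at most two:
    elimination shows that [M2] already contains both generators. *)
Lemma two_generators_length (K : unitRingType) (L G : pzRingType)
    (phiL : {rmorphism K -> L}) (phiG : {rmorphism K -> G}) (iota : {rmorphism L -> G})
    (T : lmodType G) (t1 t2 : T) :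
  division_ring K -> (forall l, iota (phiL l) = phiG l) ->
  (forall t, exists a b, t = phiG a *: t1 + phiG b *: t2) ->
  restr_length_le2 iota T.
Proof.
move=> HK iotaphi gen [M0 [M1 [M2 [M3 [[M00 _ _] [_ M1B M1Z] [_ M2B M2Z] _]]]]].
move=> [[_ [y1 [M1y1 M0y1]]] [M12 [y2 [M2y2 M1y2]]] [_ [y3 [_ M2y3]]]].
have ZK M : (forall (l : L) x, M x -> M (iota l *: x)) -> forall l (x : T), M x -> M (phiG l *: x).
  by move=> MZ l x Mx; rewrite -iotaphi; apply: MZ.
have DK M : (forall x y : T, M x -> M y -> M (x - y)) -> forall x y, M x -> M y -> M (x + y).
  by move=> MB x y Mx My; rewrite -[y]opprK -[- y]sub0r -{1}(subrr y); apply/MB/MB/My/MB.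
have VK M l (x : T) : (forall (l : L) x, M x -> M (iota l *: x)) ->
    l != 0 -> M (phiG l *: x) -> M x.
  move=> MZ l0 /(ZK _ MZ l^-1); rewrite scalerA -rmorphM mulVr ?rmorph1 ?scale1r //.
  exact: HK.
suff [M2t1 M2t2] : M2 t1 /\ M2 t2.
  by apply: M2y3; have [a [b ->]] := gen y3; apply: (DK _ M2B); apply: (ZK _ M2Z).
have [a1 [b1 y1E]] := gen y1; have [a2 [b2 y2E]] := gen y2.
have [b10|b10] := eqVneq b1 0.
  have M1t1 : M1 t1.
    move: y1E; rewrite b10 rmorph0 scale0r addr0 => y1E.
    apply: (VK _ a1) => //; last by rewrite -y1E.
    by apply/eqP => a10; apply: M0y1; rewrite y1E a10 rmorph0 scale0r.
  split; first exact: M12.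
  apply: (VK _ b2) => //; last first.
    have -> : phiG b2 *: t2 = y2 - phiG a2 *: t1 by rewrite y2E addrAC subrr add0r.
    by apply: M2B => //; apply/(ZK _ M2Z)/M12.
  apply/eqP => b20; apply: M1y2.
  by rewrite y2E b20 rmorph0 scale0r addr0; apply: ZK.
(* This multiple cancels the [t2] coefficient of [y2]; the remaining [t1] coefficient is nonzero
   because [y2] is not in [M1]. *)
pose c := b2 / b1.
have zE : phiG (a2 - c * a1) *: t1 = y2 - phiG c *: y1.
  rewrite y1E y2E scalerDr !scalerA -!rmorphM divrK; last exact: HK.
  by rewrite opprD addrACA subrr addr0 rmorphB scalerBl.
have M2t1 : M2 t1.
  apply: (VK _ (a2 - c * a1)) => //; last first.
    by rewrite zE; apply: M2B => //; apply/(ZK _ M2Z)/M12.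
  apply/eqP => z0; apply: M1y2; move: zE; rewrite z0 rmorph0 scale0r => /esym/eqP.
  by rewrite subr_eq0 => /eqP->; apply: ZK.
split=> //; apply: (VK _ b1) => //.
have -> : phiG b1 *: t2 = y1 - phiG a1 *: t1 by rewrite y1E addrAC subrr add0r.
by apply: M2B; [exact: M12|exact: ZK].
Qed.

(** * Embedding into the path algebra of the excision *)

Section Excision.
Variables (K : unitRingType) (V A V' : finType) (hd tl : A -> V) (Z : rel A).
Variables (sigma tau : A -> {rmorphism K -> K}).
Hypothesis HK : division_ring K.
Hypothesis sigmaK : forall a, cancel (sigma a) (tau a).
Hypothesis tauK : forall a, cancel (tau a) (sigma a).
Variables (hd' tl' : A -> V') (pi : V' -> V).
Hypothesis Hcut : cut_quiver hd tl Z hd' tl' pi.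
Let noZ : rel A := fun _ _ => false.
Variables (L : pzRingType) (phiL : {rmorphism K -> L}) (eL : V -> L) (xL : A -> L).
Hypothesis HL : is_semilinear_gentle_presentation hd tl sigma Z phiL eL xL.
Variables (G : pzRingType) (phiG : {rmorphism K -> G}) (eG : V' -> G) (xG : A -> G).
Hypothesis HG : is_semilinear_gentle_presentation hd' tl' sigma noZ phiG eG xG.
Variable N : nat.
Hypothesis bounded : forall s, admissible hd tl Z s -> (size s <= N)%N.

Lemma pi_hd a : pi (hd' a) = hd a. Proof. by case: Hcut. Qed.
Lemma pi_tl a : pi (tl' a) = tl a. Proof. by case: Hcut. Qed.

Lemma cut_stepE a b : (tl' b == hd' a) = adm_step hd tl Z a b.
Proof.
case: Hcut => _ _ cutP _; apply/eqP/andP => [/cutP|] [tlb nZ].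
  by split=> //; exact/eqP.
by apply/cutP; split=> //; exact/eqP.
Qed.

Lemma fiber_neq0 v : exists w, pi w = v.
Proof.
case: Hcut => _ _ _ /(_ v) card_v.
have /card_gt0P [w] : (0 < #|[set w | pi w == v]|)%N by rewrite card_v; case: ifP.
by rewrite inE => /eqP; exists w.
Qed.

(** The two points are chosen before [F], so they serve all families at once; over a non-relational
    vertex the second is a dummy copy of the first. *)
Lemma fiber_sum v (X : zmodType) : exists w1 w2, forall F : V' -> X,
  \sum_(w | pi w == v) F w = F w1 \/ \sum_(w | pi w == v) F w = F w1 + F w2.
Proof.
case: Hcut => _ _ _ /(_ v).
case: ifP => _ /eqP; [move=> /cards2P [w1 [w2 [nw12 wE]]]|move=> /cards1P [w1 wE]].
  exists w1, w2 => F; right.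
  rewrite (eq_bigl (fun w => w \in [set w1; w2])); last by move=> w; rewrite -wE inE.
  by rewrite big_setU1 ?inE //= big_set1.
exists w1, w1 => F; left.
rewrite (eq_bigl (fun w => w \in [set w1])); last by move=> w; rewrite -wE inE.
by rewrite big_set1.
Qed.

Lemma bounded_cut s : admissible hd' tl' noZ s -> (size s <= N)%N.
Proof.
move=> adm_s; apply: bounded; case: s adm_s => //= a s.
by rewrite (eq_path (e' := adm_step hd tl Z)) // => b c; rewrite /adm_step andbT cut_stepE.
Qed.

(** The idempotents over the fibres are orthogonal and sum to [1], and paths in [Z] are sent to zero
    because the reattached arrows no longer compose. *)
Lemma inclusion_ex : exists f : {rmorphism L -> G},
  [/\ forall l, f (phiL l) = phiG l, forall v, f (eL v) = \sum_(w | pi w == v) eG w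
    & forall a, f (xL a) = xG a].
Proof.
have [|f [fphi fe fx _]] := proj2 HL G phiG (fun v => \sum_(w | pi w == v) eG w) xG;
  last by exists f.
have mul_sum (v : V) w : (\sum_(w | pi w == v) eG w) * eG w = if pi w == v then eG w else 0.
  rewrite mulr_suml; case: ifPn => [wv|nwv]; last first.
    rewrite big1 // => u /eqP uv; rewrite (mul_ee HG); case: eqP => // uw.
    by rewrite -uw uv eqxx in nwv.
  rewrite (bigD1 w) //= (mul_ee HG) eqxx big1 ?addr0 // => u /andP [_ /negPf nuw].
  by rewrite (mul_ee HG) nuw.
have mul_sum' (v : V) w : eG w * (\sum_(w | pi w == v) eG w) = if pi w == v then eG w else 0.
  rewrite -mul_sum mulr_sumr mulr_suml; apply: eq_bigr => u _.
  by rewrite !(mul_ee HG) eq_sym; case: eqP => // ->.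
split.
- move=> v v'; rewrite mulr_sumr; case: eqP => [<-|nvv'].
    by apply: eq_bigr => w wv; rewrite mul_sum wv.
  rewrite big1 // => w /eqP wv'; rewrite mul_sum wv'.
  by case: eqP => // vv'; case: nvv'.
- by rewrite -(sum_e HG) (partition_big pi predT).
- by move=> v l; rewrite mulr_suml mulr_sumr; apply: eq_bigr => w _; rewrite (mul_ephi HG).
- move=> a; rewrite -(mul_hdx HG) mulrA mul_sum pi_hd eqxx; split=> //.
  by rewrite -{1}(mul_xtl HG) -!mulrA mul_sum' pi_tl eqxx (mul_xtl HG).
split=> [a l|b a Zba]; first exact: (mul_xphi HG).
apply: (mul_xx0 HG); rewrite /adm_step andbT cut_stepE /adm_step negb_and negbK.
by rewrite Zba orbT.
Qed.

Section Inclusion.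
Variable iota : {rmorphism L -> G}.
Hypothesis iotaphi : forall l, iota (phiL l) = phiG l.
Hypothesis iotae : forall v, iota (eL v) = \sum_(w | pi w == v) eG w.
Hypothesis iotax : forall a, iota (xL a) = xG a.

Notation augL := (augmentation HL).
Notation augG := (augmentation HG).

(** Both sides are ring morphisms in [r], so generators decide; of the idempotents in a fibre, at
    most one survives [augG w]. *)
Lemma aug_iota w r : augG w (iota r) = augL (pi w) r.
Proof.
elim/(generator_ind HL): r => [|r s IHr IHs|r s IHr IHs|l|v|a].
- by rewrite !rmorph1.
- by rewrite !rmorphB IHr IHs.
- by rewrite !rmorphM IHr IHs.
- by rewrite iotaphi !aug_phi.
- rewrite iotae aug_e raddf_sum /=; case: eqP => [<-|nwv].
    rewrite (bigD1 w) //= aug_e eqxx big1 ?addr0 // => u /andP [_ /negPf].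
    by rewrite aug_e eq_sym => ->.
  rewrite big1 // => u /eqP uv; rewrite aug_e.
  by case: eqP => // wu; case: nwv; rewrite wu.
- by rewrite iotax !aug_x.
Qed.

Lemma aug_iota0 r : (forall v, augL v r = 0) <-> (forall w, augG w (iota r) = 0).
Proof.
split=> [r0 w|r0 v]; first by rewrite aug_iota.
by have [w <-] := fiber_neq0 v; rewrite -aug_iota.
Qed.

(** [D] kills the degree-zero part and the terms of all arrows other than [b]. *)
Lemma derivation_iota b (r : L) (r_ : A -> L) (D : {additive G -> G}) :
  r = degree0 HL r + \sum_a xL a * r_ a ->
  (forall l g, D (phiG l * g) = phiG (tau b l) * D g) ->
  (forall a g, D (xG a * g) = if b == a then eG (tl' b) * g else 0) ->
  (forall w, D (eG w) = 0) ->
  D (iota r) = eG (tl' b) * iota (r_ b).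
Proof.
move=> -> Dphi Dx De; rewrite !raddfD !raddf_sum /= big1 => [|v _]; last first.
  rewrite rmorphM iotaphi Dphi iotae (raddf_sum D) big1 ?mulr0 //.
rewrite add0r (bigD1 b) //= rmorphM iotax Dx eqxx big1 ?addr0 // => a /negPf nab.
by rewrite rmorphM iotax Dx eq_sym nab.
Qed.

(** The core of injectivity. In the expansion of [r], a term of [b] either dies because [a] cannot
    admissibly follow [b], or inherits the hypothesis through the derivation at [b] while the word
    grows; long words vanish. *)
Lemma word_mul_eq0 a s r : eG (tl' a) * iota r = 0 -> word xL (a :: s) * r = 0.
Proof.
(* [n] bounds the number of arrows still to be added; at [n = 0] the word [a :: s] is already longer
   than [N]. *)
have [n leNn] : exists n, (N <= size s + n)%N by exists N; exact: leq_addl.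
elim: n a s r leNn => [|n IH] a s r leNn r0.
  by rewrite (word_eq0 HL bounded) ?mul0r // -[size _]addn0.
have [r_ rE] := expansion tauK HL r.
have tl_r0 : augL (tl a) r = 0.
  have := congr1 (augG (tl' a)) r0.
  by rewrite rmorphM aug_e eqxx mul1r rmorph0 aug_iota pi_tl.
rewrite rE mulrDr /= -mulrA x_degree0 tl_r0 rmorph0 !mulr0 add0r.
rewrite mulr_sumr big1 // => b _; rewrite mulrA.
have [step|] := boolP (adm_step hd tl Z b a); last first.
  by move=> /(mul_xx0 HL) x0; rewrite -[_ * xL b]mulrA x0 mulr0 mul0r.
apply: (IH b (a :: s)); first by rewrite /= addSnnS.
have [D [Dphi De Dx D0]] := derivation_ex sigmaK HG b.
rewrite -(derivation_iota rE Dphi Dx D0).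
have := congr1 D r0; rewrite De raddf0.
(* Admissibility gives [tl' a = hd' b], so [D] ignores the idempotent in front of [iota r]. *)
by rewrite -(cut_stepE b a) in step; rewrite step.
Qed.

Lemma inclusion_inj : injective iota.
Proof.
apply: raddf_inj => r r0; have [r_ rE] := expansion tauK HL r.
rewrite rE degree0_eq0 ?add0r => [|v]; last first.
  by have [w <-] := fiber_neq0 v; rewrite -aug_iota r0 rmorph0.
rewrite big1 // => b _; rewrite -[xL b]mul1r -/(word xL [:: b]).
apply: word_mul_eq0; have [D [Dphi De Dx D0]] := derivation_ex sigmaK HG b.
by rewrite -(derivation_iota rE Dphi Dx D0) r0 raddf0.
Qed.

(** Modulo the image of the radical of [L], the ring [G] is spanned over [K] by its idempotents.
    Equality of radicals, finite dimension and the length bound all rest on this. *)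
Lemma degree0_compl (y : G) : exists x : L,
  (forall v, augL v x = 0) /\ iota x = y - degree0 HG y.
Proof.
pose J g := exists x : L, (forall v, augL v x = 0) /\ iota x = g.
have JB g h : J g -> J h -> J (g - h).
  move=> [x [x0 <-]] [y' [y0 <-]]; exists (x - y'); rewrite rmorphB; split=> // v.
  by rewrite rmorphB x0 y0 subr0.
have JD g h : J g -> J h -> J (g + h).
  move=> [x [x0 <-]] [y' [y0 <-]]; exists (x + y'); rewrite rmorphD; split=> // v.
  by rewrite rmorphD x0 y0 addr0.
have J0 : J 0 by exists 0; rewrite rmorph0; split=> // v; rewrite rmorph0.
have JL l g : J g -> J (iota l * g).
  by move=> [x [x0 <-]]; exists (l * x); rewrite rmorphM; split=> // v; rewrite rmorphM x0 mulr0.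
have JxL a l : J (iota (xL a * l)).
  by exists (xL a * l); split=> // v; rewrite rmorphM aug_x mul0r.
(* [eG w] need not lie in the image of [iota], but it keeps or kills each term that begins with an
   arrow. *)
have Je w g : J g -> J (eG w * g).
  move=> [x [/(expansion0 tauK) [x_ ->] <-]].
  rewrite raddf_sum mulr_sumr; elim/big_ind: _ => //= a _.
  rewrite rmorphM iotax mulrA (mul_ex HG).
  by case: eqP => _; rewrite ?mul0r // -iotax -rmorphM.
(* Letting [z] vary makes the induction on [g] pass through products. *)
suff stable g z : J (z - degree0 HG z) -> J (g * z - degree0 HG (g * z)).
  rewrite -[y]mulr1; apply: stable.
  by rewrite -(rmorph1 phiG) degree0_phi subrr.
elim/(generator_ind HG): g z => [|g h IHg IHh|g h IHg IHh|l|w|a] z Jz.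
- by rewrite mul1r.
- by rewrite mulrBl degree0B subrACA; apply: JB; [exact: IHg|exact: IHh].
- by rewrite -mulrA; apply/IHg/IHh.
- by rewrite degree0M degree0_phi -mulrBr -iotaphi; apply: JL.
- by rewrite degree0M degree0_e -mulrBr; apply: Je.
- rewrite degree0_xM subr0 -[z](subrK (degree0 HG z)) mulrDr.
  apply: JD; first by rewrite -iotax; apply: JL.
  by rewrite x_degree0 -iotax -iotaphi -rmorphM.
Qed.

Lemma augG0_iota (y : G) : (forall w, augG w y = 0) ->
  exists x : L, (forall v, augL v x = 0) /\ iota x = y.
Proof.
by move=> y0; have [x [x0 xE]] := degree0_compl y; exists x; rewrite xE degree0_eq0 ?subr0.
Qed.

Lemma rad_inclusion (y : G) : rad y <-> exists x : L, rad x /\ iota x = y.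
Proof.
have radL := radP HK tauK HL bounded; have radG := radP HK tauK HG bounded_cut.
split=> [/radG/augG0_iota [x [x0 xE]]|[x [/radL x0 <-]]].
  by exists x; split=> //; apply/radL.
exact/radG/aug_iota0.
Qed.

(** The images of a spanning family of [L] and the idempotents of [G] span together. *)
Lemma finite_dim_cut : finite_dim_Kring phiL -> finite_dim_Kring phiG.
Proof.
move=> [n [b span]]; pose J : finType := ('I_n + V')%type.
pose bG (j : J) := match j with inl i => iota (b i) | inr w => eG w end.
exists #|J|, (bG \o enum_val) => y.
have [x [_ xE]] := degree0_compl y; have [c cE] := span x.
pose d (j : J) := match j with inl i => c i | inr w => augG w y end.
exists (d \o enum_val).
rewrite -(big_enum_val (A := J) (fun j => phiG (d j) * bG j)) (eq_bigl predT) //.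
rewrite big_sumType /= -[y in LHS](subrK (degree0 HG y)) -xE cE raddf_sum.
by congr (_ + _); apply: eq_bigr => i _; rewrite /= rmorphM iotaphi.
Qed.

Lemma length_tensor (U : lmodType L) : simple_module U ->
  forall (T : lmodType G) (beta : G -> U -> T), is_tensor iota beta ->
  restr_length_le2 iota T.
Proof.
move=> simpleU T beta tens; have [[u /eqP u0] subU] := simpleU.
have radL := radP HK tauK HL bounded.
have radU r z : (forall v, augL v r = 0) -> r *: z = 0 :> U.
  by move=> /radL; apply: simple_module_rad.
have [v ev0] : exists v, eL v *: u <> 0.
  apply/existsNP => eu0; apply: u0.
  rewrite -[u]scale1r -(sum_e HL) scaler_suml big1 // => v _; exact: eu0.
set u1 := eL v *: u in ev0.
have eu1 : eL v *: u1 = u1 by rewrite scalerA (mul_ee HL) eqxx.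
(* [u1] generates [U], and [r * eL v] agrees with [phiL (augL v r) * eL v] modulo the radical, which
   acts as zero. *)
have Uline z : exists c, z = phiL c *: u1.
  have [|Z0|all_z] := subU (fun z => exists r, z = r *: u1).
  - split=> [|_ _ [r ->] [s ->]|r _ [s ->]]; first by exists 0; rewrite scale0r.
      by exists (r - s); rewrite scalerBl.
    by exists (r * s); rewrite scalerA.
  - by case: ev0; apply: Z0; exists 1; rewrite scale1r.
  have [r ->] := all_z z; exists (augL v r).
  apply/eqP; rewrite -subr_eq0 -{1 2}eu1 !scalerA -scalerBl; apply/eqP/radU => w.
  rewrite rmorphB !rmorphM aug_phi aug_e.
  by case: eqP => [->|_]; rewrite ?mulr0 subrr.
have [[bDl bDr bal] bM _] := tens.
have b0 g : beta g 0 = 0 by apply: (addrI (beta g 0)); rewrite -bDr !addr0.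
pose t := beta 1 u1.
have [w1 [w2 fiber]] := fiber_sum v T.
apply: (two_generators_length (t1 := eG w1 *: t) (t2 := eG w2 *: t) HK iotaphi).
have comb g : exists a b, beta g u1 = phiG a *: (eG w1 *: t) + phiG b *: (eG w2 *: t).
  (* All augmentations of this difference vanish, so it comes from the radical of [L] and
     annihilates [u1]; only the idempotents above [v] remain. *)
  have [x [x0 xE]] : exists x : L, (forall v, augL v x = 0) /\
      iota x = g * iota (eL v) - \sum_(w | pi w == v) phiG (augG w g) * eG w.
    apply: augG0_iota => w; rewrite rmorphB rmorphM aug_iota aug_e raddf_sum /= eq_sym.
    apply/eqP; rewrite subr_eq0; apply/eqP.
    have aug_term w' : augG w (phiG (augG w' g) * eG w') = if w == w' then augG w g else 0.
      by rewrite rmorphM aug_phi aug_e; case: eqP => [->|_]; rewrite ?mulr1 ?mulr0.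
    rewrite (eq_bigr _ (fun w' _ => aug_term w')) -big_mkcondr /=.
    case: (eqVneq v (pi w)) => [->|nvw]; rewrite ?mulr1 ?mulr0.
      rewrite (big_pred1 w) // => w' /=; rewrite [w == _]eq_sym.
      by case: (eqVneq w' w) => [->|]; rewrite ?eqxx ?andbF.
    rewrite big_pred0 // => w'; apply/negP => /andP [/eqP w'v /eqP ww'].
    by rewrite -w'v ww' eqxx in nvw.
  have -> : beta g u1 = \sum_(w | pi w == v) phiG (augG w g) *: (eG w *: t).
    rewrite -[u1 in LHS]eu1 -bal.
    rewrite -[g * _](subrK (\sum_(w | pi w == v) phiG (augG w g) * eG w)) -xE bDl.
    rewrite -[iota x]mul1r bal radU // b0 add0r -[X in beta X _]mulr1 bM scaler_suml.
    by apply: eq_bigr => w _; rewrite scalerA.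
  case: (fiber (fun w => phiG (augG w g) *: (eG w *: t))) => ->.
    by exists (augG w1 g), 0; rewrite rmorph0 scale0r addr0.
  by exists (augG w1 g), (augG w2 g).
apply: (tensor_ind _ _ tens) => [|s s' [a [b ->]] [a' [b' ->]]|g z].
- by exists 0, 0; rewrite rmorph0 !scale0r addr0.
- by exists (a - a'), (b - b'); rewrite !rmorphB !scalerBl opprD addrACA.
have [c ->] := Uline z; rewrite -bal; exact: comb.
Qed.
End Inclusion.
End Excision.

Theorem theorem5p22
  (K : unitRingType) (HK : division_ring K)
  (V A : finType) (hd tl : A -> V) (Z : rel A)
  (sigma : A -> {rmorphism K -> K}) (Hsigma : forall a, bijective (sigma a))
  (Hgentle : gentle_pair hd tl Z)
  (V' : finType) (hd' tl' : A -> V') (pi : V' -> V)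
  (Hcut : cut_quiver hd tl Z hd' tl' pi)
  (L : pzRingType) (phiL : {rmorphism K -> L}) (eL : V -> L) (xL : A -> L)
  (HL : is_semilinear_gentle_presentation hd tl sigma Z phiL eL xL)
  (HLfin : finite_dim_Kring phiL)
  (G : pzRingType) (phiG : {rmorphism K -> G}) (eG : V' -> G) (xG : A -> G)
  (HG : is_semilinear_gentle_presentation hd' tl' sigma (fun _ _ => false) phiG eG xG) :
  nodal_connected_with phiL phiG.
Proof.
have [_ _ _ _ [N bounded]] := Hgentle.
have [tau tauP] : exists tau : A -> {rmorphism K -> K},
    forall a, cancel (sigma a) (tau a) /\ cancel (tau a) (sigma a).
  (* The inverse of each twist is bundled as a ring morphism, because it moves scalars from left to
     right across the arrow. *)
  have inv_ex a : exists t : {rmorphism K -> K}, cancel (sigma a) t /\ cancel t (sigma a).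
    have [t sK tK] := Hsigma a.
    exists (HB.pack_for {rmorphism K -> K} t
      (GRing.isZmodMorphism.Build _ _ t (can2_zmod_morphism sK tK))
      (GRing.isMonoidMorphism.Build _ _ t (can2_monoid_morphism sK tK))).
    by [].
  by have [tau tauP] := choice inv_ex; exists tau.
have sigmaK a : cancel (sigma a) (tau a) by case: (tauP a).
have tauK a : cancel (tau a) (sigma a) by case: (tauP a).
have [iota [iotaphi iotae iotax]] := inclusion_ex Hcut HL HG.
have HGfin := finite_dim_cut tauK HL HG iotaphi iotax HLfin.
split=> //.
  move=> I HI; exact: (left_ideal_projective HK sigmaK tauK HG (bounded_cut Hcut bounded)).
exists iota; split=> //.
- exact: (inclusion_inj sigmaK tauK Hcut HL HG bounded).
- exact: (rad_inclusion HK tauK Hcut HL HG bounded).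
- exact: (length_tensor HK tauK Hcut HL HG bounded).
Qed.
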